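(* Let $\Sigma$ be a finite alphabet and let $\mathcal{A}$ be a deterministic counting automaton over $\mathcal{P}(\Sigma)$. Then the density function of the language $\mathcal{L}_{\mathcal{A}}$ recognized by $\mathcal{A}$ can be defined via linear recurrence equations with coefficients in $\mathbb{N}$.
   Context: $\mathbb{N}$ includes $0$. $\Sigma$ is a finite alphabet, $\Sigma^*$ is the set of finite words over $\Sigma$, and $\varepsilon$ is the empty word. The semiring of languages is $(\mathcal{P}(\Sigma^* ), \cup, \cdot, \emptyset, \{\varepsilon\})$, where $\mathcal{P}$ denotes the power set and $\cdot$ is concatenation of languages. $\mathcal{P}(\Sigma)$ is regarded as the subset of $\mathcal{P}(\Sigma^* )$ consisting of the languages all of whose words have length exactly 1 (sets of letters, including $\emptyset$). A counting automaton $\mathcal{A}$ over $\mathcal{P}(\Sigma)$ (a weighted automaton over a one-letter input alphabet with weights in $\mathcal{P}(\Sigma)$) consists of a finite set of states $Q_{\mathcal{A}} = \{f_1, \ldots, f_k\}$ ($k \ge 1$), a single initial state $f_1$, a set of final states $F_{\mathcal{A}} \subseteq Q_{\mathcal{A}}$, and for all $1 \le i,j \le k$ a transition weight $L_{ij} \in \mathcal{P}(\Sigma)$ of the transition $f_i \to f_j$ (with $L_{ij} = \emptyset$ meaning that there is no such transition). The final weight of $f_i$ is $c_i = \{\varepsilon\}$ if $f_i \in F_{\mathcal{A}}$ and $c_i = \emptyset$ if $f_i \notin F_{\mathcal{A}}$. Each state $f_i$ generates a function $f_i : \mathbb{N} \to \mathcal{P}(\Sigma^* )$, where $f_i(n)$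 is the union, over all paths $f_i = f_{i_0} \to f_{i_1} \to \cdots \to f_{i_n}$ of length $n$ starting at $f_i$, of the languages $L_{i_0 i_1} \cdot L_{i_1 i_2} \cdots L_{i_{n-1} i_n} \cdot c_{i_n}$. Equivalently, these functions are defined by the system $$f_i(n+1) = \bigcup_{j=1}^k L_{ij} \cdot f_j(n), \quad f_i(0) = c_i, \quad 1 \le i \le k.$$ The language recognized by $\mathcal{A}$ is $\mathcal{L}_{\mathcal{A}} = \bigcup_{n \in \mathbb{N}} f_1(n)$. $\mathcal{A}$ is deterministic if for every state $f_i$, the transition weight languages $L_{i1}, L_{i2}, \ldots, L_{ik}$ are pairwise disjoint. The density function of a language $\mathcal{L} \subseteq \Sigma^*$ is the function $\rho_{\mathcal{L}} : \mathbb{N} \to \mathbb{N}$ assigning to each $n$ the number of words of length $n$ in $\mathcal{L}$. A function $g : \mathbb{N} \to \mathbb{N}$ can be defined via linear recurrence equations with coefficients in $\mathbb{N}$ if there are an integer $m \ge 1$, coefficients $a_{ij} \in \mathbb{N}$ and initial values $d_i \in \mathbb{N}$ ($1 \le i,j \le m$) such that $g = g_1$, where $g_1, \ldots, g_m : \mathbb{N} \to \mathbb{N}$ are the functions determined by $g_i(n+1) = \sum_{j=1}^m a_{ij}\, g_j(n)$, $g_i(0) = d_i$, for $1 \le i \le m$ and $n \ge 0$. *)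

(* Defs.v *)
From mathcomp Require Import all_boot.
From mathcomp Require Import boolp classical_sets.

Set Implicit Arguments.
Unset Strict Implicit.
Unset Printing Implicit Defensive.

Local Open Scope classical_set_scope.

(* Languages are arbitrary (not necessarily decidable) sets of finite words. *)
Definition language (Sigma : finType) := set (seq Sigma).

Definition lang_cat (Sigma : finType) (A B : language Sigma) : language Sigma :=
  [set u ++ v | u in A & v in B].

(* The inclusion of P(Sigma) into P(Sigma^* ). *)
Definition letters (Sigma : finType) (A : {set Sigma}) : language Sigma :=
  [set [:: a] | a in [set` A]].

(* The states f_1, ..., f_k (k >= 1) are the elements of 'I_k with
   k = ca_size.+1, and the initial state f_1 is ord0. *)
Record counting_automaton (Sigma : finType) := CountingAutomaton {
  ca_size : nat;
  ca_final : {set 'I_ca_size.+1};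
  ca_trans : 'I_ca_size.+1 -> 'I_ca_size.+1 -> {set Sigma} }.

Notation ca_state A := ('I_(ca_size A).+1).

Section CountingAutomata.

Variables (Sigma : finType) (A : counting_automaton Sigma).

Definition final_weight (i : ca_state A) : language Sigma :=
  if i \in ca_final A then [set [::]] else set0.

(* [:: i_1; ...; i_n] stands for the path i -> i_1 -> ... -> i_n. *)
Fixpoint path_weight (i : ca_state A) (p : seq (ca_state A)) : language Sigma :=
  if p is j :: q then lang_cat (letters (ca_trans i j)) (path_weight j q)
  else final_weight i.

Definition state_fun (i : ca_state A) (n : nat) : language Sigma :=
  \bigcup_(p in [set p : seq (ca_state A) | size p = n]) path_weight i p.

Lemma state_fun0 (i : ca_state A) : state_fun i 0 = final_weight i.
Proof.
apply/seteqP; split => [w [p /= /size0nil -> //]|w iw].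
by exists [::].
Qed.

Lemma state_funS (i : ca_state A) (n : nat) :
  state_fun i n.+1 =
  \bigcup_(j in [set: ca_state A])
     lang_cat (letters (ca_trans i j)) (state_fun j n).
Proof.
apply/seteqP; split => w.
  case=> -[//|j q] /= [sq] [u Lu [v qv <-]].
  by exists j => //; exists u => //; exists v => //; exists q.
case=> j _ [u Lu [v [q /= sq qv] <-]].
by exists (j :: q) => /=; [rewrite sq | exists u => //; exists v].
Qed.

Definition recognized : language Sigma :=
  \bigcup_(n in [set: nat]) state_fun ord0 n.

Definition deterministic : Prop :=
  forall i j l : ca_state A,
    j != l -> [disjoint ca_trans i j & ca_trans i l]%bool.

End CountingAutomata.

Definition density (Sigma : finType) (L : language Sigma) (n : nat) : nat :=
  #|[pred w : n.-tuple Sigma | (w : seq Sigma) \in L]|.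

(* The number of equations is m.+1 >= 1, and g_1 is g ord0. *)
Definition linear_recurrence_definable (f : nat -> nat) : Prop :=
  exists (m : nat) (a : 'I_m.+1 -> 'I_m.+1 -> nat) (d : 'I_m.+1 -> nat)
         (g : 'I_m.+1 -> nat -> nat),
    [/\ forall i, g i 0 = d i,
        forall i n, g i n.+1 = \sum_(j < m.+1) a i j * g j n
      & forall n, f n = g ord0 n].

(* Main.v *)
(** Let [g i n] be the number of words of length [n] generated by the state
    [i].  A word [a w] generated by [i] comes from some transition [i -> j]
    whose label contains [a], with [w] generated by [j]; determinism makes [j]
    unique, so the unions defining the languages are disjoint and
    [g i (n + 1)] is the sum over [j] of [#|L_ij| * g j n]. *)

Require Import Defs.
From mathcomp Require Import all_boot.
From mathcomp Require Import classical_sets.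

Set Implicit Arguments.
Unset Strict Implicit.
Unset Printing Implicit Defensive.

(** Splitting off the head is a bijection from (n+1)-tuples to pairs of a letter and an n-tuple. [F]
    takes plain sequences, so no tuple casts arise. *)
Lemma big_tuple_cons (R : Type) (idx : R) (op : Monoid.com_law idx)
    (T : finType) (n : nat) (F : seq T -> R) :
  \big[op/idx]_(w : n.+1.-tuple T) F w =
  \big[op/idx]_(a : T) \big[op/idx]_(w : n.-tuple T) F (a :: w).
Proof.
rewrite pair_big /=.
rewrite (reindex (fun p : T * n.-tuple T => cons_tuple p.1 p.2)) //=.
exists (fun w => (thead w, behead_tuple w)) => [[a w] _|w _] /=.
  by rewrite theadE; congr pair; apply: val_inj.
by rewrite [RHS]tuple_eta; apply: val_inj.
Qed.

Lemma density_sum (Sigma : finType) (L : language Sigma) (n : nat) :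
  density L n = \sum_(w : n.-tuple Sigma) ((w : seq Sigma) \in L).
Proof. by rewrite /density -sum1_card big_mkcond. Qed.

Section StateFun.

Variables (Sigma : finType) (A : counting_automaton Sigma).
Implicit Types (i j : ca_state A) (n : nat) (w : seq Sigma).

(** Labels consist of one-letter words, so each transition contributes exactly one letter. *)
Lemma size_state_fun i n w : state_fun i n w -> size w = n.
Proof.
elim: n i w => [|n IHn] i w.
  by rewrite state_fun0 /final_weight; case: ifP => // _ ->.
rewrite state_funS => -[j _ [u [a _ <-] [v jv <-]]] /=.
by rewrite (IHn _ _ jv).
Qed.

(** By length, only the index [size w] of the union can contribute [w]. *)
Lemma mem_recognized w :
  (w \in recognized A) = (w \in state_fun (ord0 : ca_state A) (size w)).
Proof.
apply/idP/idP; rewrite !in_setE.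
  by case=> n _ nw; rewrite (size_state_fun nw).
by move=> w_in; exists (size w).
Qed.

Lemma density_recognized n :
  density (recognized A) n = density (state_fun (ord0 : ca_state A) n) n.
Proof.
by apply: eq_card => w; rewrite !inE mem_recognized size_tuple.
Qed.

Lemma state_funS_cons i n a w :
  state_fun i n.+1 (a :: w) <->
  exists2 j, a \in ca_trans i j & state_fun j n w.
Proof.
rewrite state_funS; split=> [[j _ [_ [b ijb <-] [v jv [<- <-]]]]|[j ija jw]].
  by exists j.
by exists j => //; exists [:: a]; [exists a | exists w].
Qed.

(** Booleans count as 0 or 1: by disjointness of the labels leaving [i], at most one of them
    contains [a], so at most one term is nonzero. *)
Lemma deterministic_state_funS i n a w : deterministic A ->
  (a :: w \in state_fun i n.+1) =
    \sum_j (a \in ca_trans i j) * (w \in state_fun j n) :> nat.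
Proof.
move=> detA; have [|awN] := boolP (a :: w \in _).
  rewrite in_setE => /state_funS_cons[j ija /mem_set jw].
  rewrite (bigD1 j) //= ija jw big1 // => l neq_lj.
  by rewrite (disjointFr (detA i j l _) ija) // eq_sym.
rewrite big1 // => j _; apply/eqP; rewrite mulnb eqb0.
apply: contra awN => /andP[ija]; rewrite !in_setE => jw.
by apply/state_funS_cons; exists j.
Qed.

Lemma density_state_funS i n : deterministic A ->
  density (state_fun i n.+1) n.+1 =
  \sum_j #|ca_trans i j| * density (state_fun j n) n.
Proof.
move=> detA; rewrite density_sum.
rewrite (big_tuple_cons _ _ (fun w => nat_of_bool (w \in state_fun i n.+1))).
under eq_bigr do under eq_bigr do rewrite deterministic_state_funS //.
under eq_bigr do rewrite exchange_big.
rewrite exchange_big; apply: eq_bigr => j _.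
(* For fixed [j] the summand is a factor in the letter times a factor in the tail, so the double sum
   splits into a product of two counts. *)
by rewrite density_sum -sum1_card [in RHS]big_mkcond big_distrlr.
Qed.

End StateFun.

Theorem theorem5p1 (Sigma : finType) (A : counting_automaton Sigma) :
  deterministic A -> linear_recurrence_definable (density (recognized A)).
Proof.
move=> detA; exists (ca_size A), (fun i j => #|ca_trans i j|),
  (fun i => density (state_fun i 0) 0), (fun i n => density (state_fun i n) n).
split=> // [i n|n]; first exact: density_state_funS.
exact: density_recognized.
Qed.
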